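(* Let $\mathbf{k}$ be a commutative unital ring, $\lambda\in\mathbf{k}$, let $(A,\mu)$ be a commutative algebra over $\mathbf{k}$ and $\mathcal{D}:A\to A$ a modified derivation of weight $\lambda$. Define $$a\rhd_{\mathcal{D}}b:=a\mathcal{D}(b)\quad\text{for }a,b\in A.$$ Then $(A,\rhd_{\mathcal{D}})$ is a pre-Lie algebra and a Novikov algebra.
   Context: An algebra is an associative algebra, possibly without unit. A modified derivation of weight $\lambda$ of an algebra $A$ is a linear map $\mathcal{D}:A\to A$ with $\mathcal{D}(ab)=a\mathcal{D}(b)+\mathcal{D}(a)b+\lambda ab$ for all $a,b\in A$. A (left) pre-Lie algebra is a $\mathbf{k}$-module $A$ with a bilinear operation $\rhd$ satisfying $(a\rhd b)\rhd c-a\rhd(b\rhd c)=(b\rhd a)\rhd c-b\rhd(a\rhd c)$ for all $a,b,c\in A$. A Novikov algebra is a (left) pre-Lie algebra $(A,\rhd)$ satisfying in addition $(a\rhd b)\rhd c=(a\rhd c)\rhd b$ for all $a,b,c\in A$. *)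

(* Defs.v *)
From mathcomp Require Import all_boot all_algebra.

Set Implicit Arguments.
Unset Strict Implicit.
Unset Printing Implicit Defensive.

Import GRing.Theory.
Local Open Scope ring_scope.

(* MathComp's algebra structures (lalgType, algType, ...) are unital, so an
   algebra here is a product on an lmodType, with no unit required.  The base
   ring is a comPzRingType, so the zero ring is allowed; this is also why
   sesquilinear.bilinear_for, which needs an nzRingType, is not used. *)

Definition bilinear_op (k : comPzRingType) (A : lmodType k)
    (op : A -> A -> A) : Prop :=
  (forall b : A, linear (op^~ b)) /\ (forall a : A, linear (op a)).

Record is_algebra (k : comPzRingType) (A : lmodType k)
    (mu : A -> A -> A) : Prop := IsAlgebra {
  algebra_bilinear : bilinear_op mu;
  algebra_assoc : associative mu
}.

Record is_commutative_algebra (k : comPzRingType) (A : lmodType k)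
    (mu : A -> A -> A) : Prop := IsCommutativeAlgebra {
  commutative_algebra_algebra : is_algebra mu;
  commutative_algebra_comm : commutative mu
}.

Record is_modified_derivation (k : comPzRingType) (lambda : k) (A : lmodType k)
    (mu : A -> A -> A) (D : A -> A) : Prop := IsModifiedDerivation {
  modified_derivation_linear : linear D;
  modified_derivation_mul : forall a b : A,
    D (mu a b) = mu a (D b) + mu (D a) b + lambda *: mu a b
}.

Record is_preLie (k : comPzRingType) (A : lmodType k)
    (op : A -> A -> A) : Prop := IsPreLie {
  preLie_bilinear : bilinear_op op;
  preLie_assoc_sym : forall a b c : A,
    op (op a b) c - op a (op b c) = op (op b a) c - op b (op a c)
}.

Record is_Novikov (k : comPzRingType) (A : lmodType k)
    (op : A -> A -> A) : Prop := IsNovikov {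
  Novikov_preLie : is_preLie op;
  Novikov_right_comm : forall a b c : A, op (op a b) c = op (op a c) b
}.

Definition rhd_of (T : Type) (mu : T -> T -> T) (D : T -> T) (a b : T) : T :=
  mu a (D b).

(* Main.v *)
Require Import Defs.
From mathcomp Require Import all_boot all_algebra.
Import GRing.Theory.
Local Open Scope ring_scope.

(** Write [ab] for [mu a b].  Expanding [D (b (D c))] by the modified Leibniz
    rule, the term [a (D b) (D c)] cancels in the associator of
    [a |> b := a (D b)], which leaves
      [(a |> b) |> c - a |> (b |> c) = - (ab) (D (D c) + lambda (D c))]
    ([rhd_associator]).  The right-hand side depends on [a] and [b] only
    through [ab], so commutativity of [mu] gives the pre-Lie identity.  The
    Novikov identity holds because [a (D b) (D c)] is symmetric in [b] and
    [c]. *)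

Lemma rhd_bilinear (k : comPzRingType) (A : lmodType k)
    (mu : A -> A -> A) (D : A -> A) :
  bilinear_op mu -> linear D -> bilinear_op (rhd_of mu D).
Proof.
case=> mu_linl mu_linr D_lin; split=> [b | a] x u v; rewrite /rhd_of.
  exact: mu_linl.
by rewrite D_lin mu_linr.
Qed.

(** Writing the associator as a function of [mu a b] and [c] turns the pre-Lie
    identity into a rewrite with commutativity.  The weight enters only through
    the second factor, so it does not affect the symmetry in [a] and [b]. *)
Lemma rhd_associator (k : comPzRingType) (lambda : k) (A : lmodType k)
    (mu : A -> A -> A) (D : A -> A) (a b c : A) :
  is_algebra mu -> is_modified_derivation lambda mu D ->
  rhd_of mu D (rhd_of mu D a b) c - rhd_of mu D a (rhd_of mu D b c)
  = - mu (mu a b) (D (D c) + lambda *: D c).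
Proof.
case=> -[_ mu_linr] muA [_ D_mul]; rewrite /rhd_of D_mul.
have muDr x u v : mu x (u + v) = mu x u + mu x v.
  by have := mu_linr x 1 u v; rewrite !scale1r.
have muZr x r u : mu x (r *: u) = r *: mu x u.
  exact: (scalable_linear (mu_linr x)).
by rewrite !muDr !muZr !muA addrAC [X in _ - X]addrC opprD addNKr.
Qed.

Theorem corollary5p9 (k : comPzRingType) (lambda : k) (A : lmodType k)
    (mu : A -> A -> A) (D : A -> A)
    (hmu : is_commutative_algebra mu)
    (hD : is_modified_derivation lambda mu D) :
  is_preLie (rhd_of mu D) /\ is_Novikov (rhd_of mu D).
Proof.
have [alg_mu muC] := hmu; have [mu_bilin muA] := alg_mu.
have preLie_rhd : is_preLie (rhd_of mu D).
  split=> [|a b c].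
    exact: rhd_bilinear _ _ _ _ mu_bilin (modified_derivation_linear hD).
  by rewrite !(rhd_associator _ _ _ _ _ _ _ _ alg_mu hD) (muC a b).
split=> //; split=> // a b c.
by rewrite /rhd_of -!muA (muC (D b)).
Qed.
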